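(* There exist universal constants $c,c'>0$ such that the following holds. Let $n\in\mathbb{N}$, $\sigma^2>0$, $0<\tau_1\le\dots\le\tau_n$, $L,\Delta>0$, $0<\varepsilon\le c'L\Delta$. Let $A=\{A_d\}_{d\in\mathbb{N}}$ be a family of zero-respecting algorithms for the time oracle protocol. Then there exist $d$, $f\in\mathcal{F}_{\Delta,L}$ on $\mathbb{R}^d$ and an admissible choice $(O,\mathcal{D})\in\mathcal{O}^{\sigma^2,\mathrm{sync}}_{\tau_1,\dots,\tau_n}(f)$ such that $$\mathbb{E}\Big[\inf_{k\in S_t}\|\nabla f(x^k)\|^2\Big]>\varepsilon\quad\text{for}\quad t=c\cdot\min_{m\in[n]}\left[\tau_m\Big(\frac{L\Delta}{\varepsilon}+\frac{\sigma^2L\Delta}{m\varepsilon^2}\Big)\right].$$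
   Context: Notation: $[n]=\{1,\dots,n\}$, $\mathbb{N}_0=\{0,1,\dots\}$, $\mathrm{supp}(x)=\{i:x_i\ne0\}$. Time oracle protocol (single oracle). An algorithm is $A^0\in\mathbb{R}_{\ge0}\times\mathbb{R}^d$ and $A^k:(\mathbb{R}^d)^k\to\mathbb{R}_{\ge0}\times\mathbb{R}^d$ ($k\ge1$) such that the first (time) component of $A^k(g^1,\dots,g^k)$ is at least that of $A^{k-1}(g^1,\dots,g^{k-1})$. Set $t^0=0$ and oracle state $s^0=(0,0,0)\in\mathbb{R}_{\ge0}\times\mathbb{R}^d\times\{0,1\}$. For $k=0,1,\dots$: $(t^{k+1},x^k)=A^k(g^1,\dots,g^k)$; draw $\xi^{k+1}=(\xi^{k+1}_1,\dots,\xi^{k+1}_n)\sim\mathcal{D}$ independently of the past; $(s^{k+1},g^{k+1})=O(t^{k+1},x^k,s^k,\xi^{k+1})$. $S_t=\{k\in\mathbb{N}_0:t^k\le t\}$. Zero-respecting: $\mathrm{supp}(x^k)\subseteq\bigcup_{j=1}^k\mathrm{supp}(g^j)$ for all $k$ and all realizations. Synchronized oracle: for a mapping $G:\mathbb{R}^d\times\mathbb{S}_\xi\to\mathbb{R}^d$, $O^G_{\tau_1,\dots,\tau_n}(t,x,(s_t,s_x,s_q),(\xi_1,\dots,\xi_n))$ returns $((t,x,1),0)$ if $s_q=0$, and if $s_q=1$ returns $\big((0,0,0),\sum_{i\in[n]:\,s_t+\tau_i\le t}G(s_x;\xi_i)\big)$ (empty sum $=0$). Function class $\mathcal{F}_{\Delta,L}$: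 differentiable $f:\mathbb{R}^d\to\mathbb{R}$ with $\|\nabla f(x)-\nabla f(y)\|\le L\|x-y\|$ and $f(0)-\inf f\le\Delta$. Oracle class $\mathcal{O}^{\sigma^2,\mathrm{sync}}_{\tau_1,\dots,\tau_n}(f)$: an admissible choice is a sample space $\mathbb{S}_\xi$, a distribution $\mathcal{D}_0$ on it, and a mapping $G$ with $\mathbb{E}_{\xi\sim\mathcal{D}_0}[G(x;\xi)]=\nabla f(x)$, $\mathbb{E}_{\xi\sim\mathcal{D}_0}\|G(x;\xi)-\nabla f(x)\|^2\le\sigma^2$ for all $x$; then $\mathcal{D}=\mathcal{D}_0^{\otimes n}$ and $O=O^G_{\tau_1,\dots,\tau_n}$. *)

(* Defs.v *)
From HB Require Import structures.
From mathcomp Require Import all_boot all_order all_algebra.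
From mathcomp Require Import all_classical all_reals all_analysis.
Import Order.TTheory GRing.Theory Num.Theory.

Set Implicit Arguments.
Unset Strict Implicit.
Unset Printing Implicit Defensive.

Local Open Scope ring_scope.
Local Open Scope classical_set_scope.

Section Defs.
Variable R : realType.

(* vectors of R^d are row vectors 'rV[R]_d, seen as a normed module (the
   canonical MathComp-Analysis normed-module instance on matrices) so that
   differentiability makes sense; vec d is definitionally 'rV[R]_d. *)
Definition vec (d : nat) : normedModType R :=
  matrix_matrix__canonical__normed_module_NormedModule R 1 d.

Definition sqnorm2 (d : nat) (v : vec d) : R := \sum_(i < d) (v 0 i) ^+ 2.
Definition norm2 (d : nat) (v : vec d) : R := Num.sqrt (sqnorm2 v).

Definition grad (d : nat) (f : vec d -> R) (x : vec d) : vec d :=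
  \row_(i < d) ('d f x (delta_mx 0 i : 'rV[R]_d)).

Definition in_F_class (d : nat) (Delta L : R) (f : vec d -> R) : Prop :=
  (forall x, differentiable f x) /\
  (forall x y, norm2 (grad f x - grad f y) <= L * norm2 (x - y)) /\
  (* f(0) - inf f <= Delta *)
  (forall x, f 0 - f x <= Delta).

(* An algorithm on R^d : A gs = A^k(g^1,...,g^k) for gs = [:: g^1; ...; g^k];
   the first component is the time, the second the query point. *)
Definition algorithm (d : nat) := seq (vec d) -> R * vec d.

Definition valid_algorithm (d : nat) (A : algorithm d) : Prop :=
  (forall gs, 0 <= (A gs).1) /\
  (forall gs g, (A gs).1 <= (A (rcons gs g)).1).

Definition zero_respecting (d : nat) (A : algorithm d) : Prop :=
  forall (gs : seq (vec d)) (j : 'I_d),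
    (A gs).2 0 j != 0 -> has (fun g : vec d => g 0 j != 0) gs.

Definition ostate (d : nat) := (R * vec d * bool)%type.

(* the synchronized oracle O^G_{tau_1..tau_n}; worker i : 'I_n is worker i+1 *)
Definition sync_oracle (d n : nat) (S : Type) (G : vec d -> S -> vec d)
    (tau : 'I_n -> R) (t : R) (x : vec d) (s : ostate d) (xi : 'I_n -> S)
    : ostate d * vec d :=
  let: (st, sx, sq) := s in
  if ~~ sq then ((t, x, true), 0)
  else ((0, 0, false), \sum_(i < n | st + tau i <= t) G sx (xi i)).

(* Run of the time oracle protocol with a (deterministic) oracle O and the
   realization xis k = xi^{k+1}.  run k = ([:: g^1; ...; g^k], s^k). *)
Fixpoint run (d : nat) (S : Type) (A : algorithm d)
    (O : R -> vec d -> ostate d -> S -> ostate d * vec d)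
    (xis : nat -> S) (k : nat) : seq (vec d) * ostate d :=
  match k with
  | 0 => ([::], (0, 0, false))
  | k'.+1 =>
      let: (gs, s) := run A O xis k' in
      let: (t, x) := A gs in
      let: (s', g) := O t x s (xis k') in
      (rcons gs g, s')
  end.

Definition query (d : nat) (S : Type) (A : algorithm d) O (xis : nat -> S) (k : nat)
  : vec d := (A (run A O xis k).1).2.

(* time t^k, with t^0 = 0 and (t^{k+1}, x^k) = A^k(g^1..g^k) *)
Definition time (d : nat) (S : Type) (A : algorithm d) O (xis : nat -> S) (k : nat)
  : R := match k with 0 => 0 | k'.+1 => (A (run A O xis k').1).1 end.

Definition inf_grad (d : nat) (S : Type) (A : algorithm d) O (xis : nat -> S)
    (f : vec d -> R) (t : R) : \bar R :=
  ereal_inf [set (sqnorm2 (grad f (query A O xis k)))%:E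
            | k in [set k | time A O xis k <= t]].

Definition admissible_oracle (d : nat) (f : vec d -> R) (sigma2 : R)
    (dS : measure_display) (S : measurableType dS) (D0 : probability S R)
    (G : vec d -> S -> vec d) : Prop :=
  (forall x (i : 'I_d), D0.-integrable setT (fun xi => (G x xi 0 i)%:E) /\
     (\int[D0]_xi (G x xi 0 i)%:E = (grad f x 0 i)%:E)%E) /\
  (forall x, (\int[D0]_xi (sqnorm2 (G x xi - grad f x))%:E <= sigma2%:E)%E).

(* X : nat -> 'I_n -> Om -> S is a family of mutually independent random
   variables, each with law D0 (i.e. the sequence xi^1, xi^2, ... is i.i.d.
   with law D = D0^{(x) n}) *)
Definition iid_with_law (dO : measure_display) (Om : measurableType dO)
    (P : probability Om R) (dS : measure_display) (S : measurableType dS)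
    (D0 : probability S R) (n : nat) (X : nat -> 'I_n -> Om -> S) : Prop :=
  (forall k i, measurable_fun setT (X k i)) /\
  (forall k i (B : set S), measurable B -> P (X k i @^-1` B) = D0 B) /\
  (forall (J : seq (nat * 'I_n)) (B : nat * 'I_n -> set S),
     uniq J -> (forall j, measurable (B j)) ->
     P (\bigcap_(j in [set` J]) (X j.1 j.2 @^-1` B j)) =
     (\prod_(j <- J) P (X j.1 j.2 @^-1` B j))%E).

Definition min_ord (n : nat) (hn : (0 < n)%N) (F : 'I_n -> R) : R :=
  \big[Num.min/F (Ordinal hn)]_(m < n) F m.

End Defs.

(* Main.v *)
Require Import Defs.
From HB Require Import structures.
From mathcomp Require Import all_boot all_order all_algebra.
From mathcomp Require Import all_classical all_reals all_analysis.
From mathcomp Require Import ring lra.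
Import Order.TTheory GRing.Theory Num.Theory.
Import numFieldNormedType.Exports.
Set Implicit Arguments.
Unset Strict Implicit.
Unset Printing Implicit Defensive.
Local Open Scope ring_scope.
Local Open Scope classical_set_scope.

(* The hard function is a rescaled chain of about L * Delta / eps coordinates:
   a coordinate has a nonzero partial derivative at x only once its predecessor
   has become nonzero, and |grad f|^2 >= 4 * eps as long as the last coordinate
   is zero.  The stochastic gradient multiplies the not yet discovered
   coordinates by xi / p, with xi Bernoulli of parameter p ~ eps / sigma2.  A
   round of the oracle in which m workers finish lasts at least tau_m and
   reveals one new coordinate with probability at most min(1, p * m), and none
   otherwise.  Hence the number of revealed coordinates minus a constant times
   the elapsed time is a supermartingale, and by Markov's inequality the last
   coordinate stays zero up to time t with probability at least 1/2. *)

(** * A smooth step function *)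

Section SmoothStep.
Variable R : realType.
Implicit Types x y : R.

Definition pospart x : R := Num.max x 0.

(** The C^1 piecewise quadratic step from 0 to 1 on [0, 1]; its derivative is the tent of height 2
    with peak at 1/2. Through [pospart] all calculus reduces to the derivative of one squared
    positive part. *)
Definition smoothstep x : R :=
  2 * pospart x ^+ 2 - 4 * pospart (x - 2^-1) ^+ 2 + 2 * pospart (x - 1) ^+ 2.

Definition dsmoothstep x : R :=
  4 * pospart x - 8 * pospart (x - 2^-1) + 4 * pospart (x - 1).

Lemma pospart_ge0 x : 0 <= pospart x.
Proof. by rewrite /pospart le_max lexx orbT. Qed.

Lemma pospart_lip x y : `|pospart x - pospart y| <= `|x - y|.
Proof.
rewrite /pospart; case: (leP x 0) => hx; case: (leP y 0) => hy.
- by rewrite subrr normr0.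
- by rewrite ler_norml; have := ler_norm (y - x); rewrite distrC; lra.
- by rewrite ler_norml; have := ler_norm (x - y); lra.
- by [].
Qed.

Lemma is_derive_sqr_pospart x :
  is_derive x 1 (fun z : R => pospart z ^+ 2) (2 * pospart x).
Proof.
apply/is_derive1_caratheodory.
exists (fun z => if z == x then 2 * pospart x
                 else (pospart z ^+ 2 - pospart x ^+ 2) / (z - x)).
split; last by rewrite eqxx.
  move=> z; case: eqVneq => [->|zx]; first by rewrite !subrr mulr0.
  by rewrite divfK// subr_eq0.
(* The difference quotient stays within |x - z| of the claimed derivative, also across the kink at
   0, so the slope function is continuous at [x]. *)
have H z : `|2 * pospart x - (if z == x then 2 * pospart x
     else (pospart z ^+ 2 - pospart x ^+ 2) / (z - x))| <= `|x - z|.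
  case: eqVneq => [->|zx]; first by rewrite !subrr.
  have zx0 : z - x != 0 by rewrite subr_eq0.
  rewrite -(ler_pM2r (_ : 0 < `|z - x|)) ?normr_gt0// -normrM.
  rewrite mulrBl divfK//.
  rewrite (distrC x z) -normrM -expr2 [leRHS]ger0_norm ?sqr_ge0// ler_norml.
  rewrite /pospart; case: (leP x 0) => hx; case: (leP z 0) => hz; nra.
apply/cvgrPdist_le => e e0; near=> z.
rewrite eqxx; apply: le_trans (H z) _; near: z.
by apply/nbhs_ballP; exists e => //= z; rewrite /ball /= => /ltW.
Unshelve. all: by end_near. Qed.

Lemma is_derive_smoothstep x : is_derive x 1 smoothstep (dsmoothstep x).
Proof.
have shiftD (a : R) : is_derive x 1 (fun z : R => pospart (z - a) ^+ 2) (2 * pospart (x - a)).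
  have h1 := is_derive_sqr_pospart (x - a).
  have h2 : is_derive x 1 (fun z : R => z - a) 1.
    by apply: is_derive_eq; rewrite subr0.
  by apply: (is_derive_eq (is_derive1_comp (g := fun z : R => z - a) h1 h2)); rewrite mulr1.
have h0 := is_derive_sqr_pospart x.
have h1 := shiftD 2^-1.
have h2 := shiftD 1.
have := is_deriveD (is_deriveB (is_deriveZ 2 h0) (is_deriveZ 4 h1)) (is_deriveZ 2 h2).
move/is_derive_eq; apply; rewrite /dsmoothstep /GRing.scale /=; lra.
Qed.

Lemma dsmoothstep_ge0 x : 0 <= dsmoothstep x.
Proof.
rewrite /dsmoothstep /pospart.
by case: (leP x 0); case: (leP (x - 2^-1) 0); case: (leP (x - 1) 0); lra.
Qed.

Lemma dsmoothstep_le2 x : dsmoothstep x <= 2.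
Proof.
rewrite /dsmoothstep /pospart.
by case: (leP x 0); case: (leP (x - 2^-1) 0); case: (leP (x - 1) 0); lra.
Qed.

Lemma dsmoothstep_eq0 x : x <= 0 -> dsmoothstep x = 0.
Proof.
rewrite /dsmoothstep /pospart.
by case: (leP x 0); case: (leP (x - 2^-1) 0); case: (leP (x - 1) 0); lra.
Qed.

(** For z in [-1, 1] the argument (z + 2) / 4 of [ramp] runs through exactly this interval. *)
Lemma dsmoothstep_ge1 x : 4^-1 <= x <= 3 / 4 -> 1 <= dsmoothstep x.
Proof.
rewrite /dsmoothstep /pospart.
by case: (leP x 0); case: (leP (x - 2^-1) 0); case: (leP (x - 1) 0); lra.
Qed.

Lemma smoothstep_eq0 x : x <= 0 -> smoothstep x = 0.
Proof.
rewrite /smoothstep /pospart.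
by case: (leP x 0); case: (leP (x - 2^-1) 0); case: (leP (x - 1) 0); lra.
Qed.

Lemma smoothstep_eq1 x : 1 <= x -> smoothstep x = 1.
Proof.
rewrite /smoothstep /pospart.
by case: (leP x 0); case: (leP (x - 2^-1) 0); case: (leP (x - 1) 0); nra.
Qed.

Lemma smoothstep_ge0 x : 0 <= smoothstep x.
Proof.
rewrite /smoothstep /pospart.
by case: (leP x 0); case: (leP (x - 2^-1) 0); case: (leP (x - 1) 0); nra.
Qed.

Lemma smoothstep_le1 x : smoothstep x <= 1.
Proof.
rewrite /smoothstep /pospart.
by case: (leP x 0); case: (leP (x - 2^-1) 0); case: (leP (x - 1) 0); nra.
Qed.

(** 16 = 4 + 8 + 4 adds the Lipschitz constants of the three terms. *)
Lemma dsmoothstep_lip x y : `|dsmoothstep x - dsmoothstep y| <= 16 * `|x - y|.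
Proof.
have h0 := pospart_lip x y.
have := pospart_lip (x - 2^-1) (y - 2^-1).
have := pospart_lip (x - 1) (y - 1).
rewrite /dsmoothstep !opprB !addrA.
rewrite (_ : x - 1 + 1 - y = x - y); last lra.
rewrite (_ : x - 2^-1 + 2^-1 - y = x - y); last lra.
move: h0; rewrite !ler_norml => /andP[? ?] /andP[? ?] /andP[? ?].
by apply/andP; split; lra.
Qed.

Lemma smoothstep_lip x y : `|smoothstep x - smoothstep y| <= 2 * `|x - y|.
Proof.
wlog xy : x y / x < y.
  move=> H; case: (ltgtP x y) => [/H//|/H|->]; last by rewrite !subrr normr0 mulr0.
  by rewrite distrC (distrC y).
have [||c _ E] := @MVT _ smoothstep dsmoothstep x y xy.
- by move=> z _; exact: is_derive_smoothstep.
- apply: derivable_within_continuous => z _.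
  by have [] := is_derive_smoothstep z.
rewrite distrC E normrM (distrC x) ler_wpM2r//.
by rewrite ger0_norm ?dsmoothstep_ge0 ?dsmoothstep_le2.
Qed.

End SmoothStep.

(** * The zero-chain *)

Lemma is_diff_sum (R : numFieldType) (V W : normedModType R) n
    (f df : 'I_n -> V -> W) (x : V) :
  (forall i, is_diff x (f i) (df i)) ->
  is_diff x (\sum_(i < n) f i) (\sum_(i < n) df i).
Proof.
by move=> h; elim/big_ind2 : _ => // [|*]; [exact: is_diff_cst|exact: is_diffD].
Qed.

Lemma is_diff_of_derive (R : realType) (f : R -> R) (x a : R) :
  is_derive x 1 f a -> is_diff x f (fun h => h * a).
Proof.
move=> [df fa]; apply: DiffDef; first exact/derivable1_diffP.
by rewrite deriv1E// derive1E fa.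
Qed.

Lemma grad_is_diff (R : realType) d (f df : vec R d -> R) (x : vec R d) (i : 'I_d) :
  is_diff x f df -> grad f x 0 i = df (delta_mx 0 i : 'rV[R]_d).
Proof. by move=> h; rewrite mxE diff_val. Qed.

Lemma sqnorm2_ge0 (R : realType) d (v : vec R d) : 0 <= sqnorm2 v.
Proof. by apply: sumr_ge0 => i _; exact: sqr_ge0. Qed.

Lemma sqnorm2Z (R : realType) d (c : R) (v : vec R d) :
  sqnorm2 (c *: v) = c ^+ 2 * sqnorm2 v.
Proof. by rewrite /sqnorm2 mulr_sumr; apply: eq_bigr => i _; rewrite mxE exprMn. Qed.

(** * Gradients under rescaling of argument and value *)

Section Rescaling.
Variables (R : realType) (d : nat) (g : vec R d -> R) (a lam : R).
Hypothesis dg : forall x, differentiable g x.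

Let f (x : vec R d) : R := a * g (lam *: x).

Let is_diff_f x : is_diff x f (fun h => a * 'd g (lam *: x) (lam *: h)).
Proof.
have h1 := is_diff_scaler lam x.
have h2 := differentiableP (dg (lam *: x)).
exact: (is_diffZ a (is_diff_comp h1 h2)).
Qed.

Lemma differentiable_rescale x : differentiable f x.
Proof. by have [] := is_diff_f x. Qed.

Lemma grad_rescale x : grad f x = (a * lam) *: grad g (lam *: x).
Proof.
apply/rowP => i; rewrite (grad_is_diff i (is_diff_f x)) !mxE.
by rewrite linearZ /= mulrA.
Qed.

End Rescaling.

Section Chain.
Variables (R : realType) (T : nat).
Implicit Types x y h : vec R T.

(** Indices are shifted by one, so that every coordinate has a predecessor and a successor and sums
    over the chain need no end cases. With [a = b = 0] this is the derivative of the affine map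
    given by other paddings. *)
Definition padded (a b : R) x (k : nat) : R :=
  if k is k'.+1 then oapp (fun i : 'I_T => x 0 i) b (insub k') else a.
Arguments padded : simpl never.

Lemma paddedS a b x (i : 'I_T) : padded a b x i.+1 = x 0 i.
Proof. by rewrite /padded valK. Qed.

Lemma padded_out a b x k : (T <= k)%N -> padded a b x k.+1 = b.
Proof. by move=> Tk; rewrite /padded insubN// -leqNgt. Qed.

Lemma paddedB a b x y k :
  padded a b x k - padded a b y k = padded 0 0 (x - y) k.
Proof.
rewrite /padded; case: k => [|k]; first by rewrite subrr.
by case: insubP => [i _ _|_]/=; rewrite ?subrr// !mxE.
Qed.

Lemma padded_delta (j : 'I_T) k :
  padded 0 0 (delta_mx 0 j : 'rV[R]_T) k = (k == j.+1)%:R.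
Proof.
case: k => [//|k]; have [kT|kT] := ltnP k T.
  by rewrite (paddedS _ _ _ (Ordinal kT)) mxE eqxx eqSS.
by rewrite padded_out// eqSS gtn_eqF// (leq_trans _ kT).
Qed.

Lemma is_diff_padded a b x k :
  is_diff x (fun z : vec R T => padded a b z k) (fun h => padded 0 0 h k).
Proof.
rewrite /padded; case: k => [|k]; first exact: is_diff_cst.
case: insubP => [i _ _|_] /=; last exact: is_diff_cst.
pose c (z : vec R T) : R := z 0 i.
have lc : linear c by move=> r u v; rewrite /c !mxE.
pose lcM := GRing.isLinear.Build _ _ _ _ _ lc.
pose cL : {linear vec R T -> R} := HB.pack c lcM.
have cc : continuous cL by exact: coord_continuous.
apply: DiffDef; first exact: linear_differentiable cc.
exact: diff_lin cc.
Qed.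

(** The three shifts match the three terms of [dchain_lip]; the outer two trade an end coordinate
    for a zero. *)
Lemma sum_padded_sqr h :
  [/\ \sum_(j < T) padded 0 0 h j ^+ 2 <= sqnorm2 h,
      \sum_(j < T) padded 0 0 h j.+1 ^+ 2 = sqnorm2 h &
      \sum_(j < T) padded 0 0 h j.+2 ^+ 2 <= sqnorm2 h].
Proof.
have E : \sum_(j < T) padded 0 0 h j.+1 ^+ 2 = sqnorm2 h.
  by apply: eq_bigr => i _; rewrite paddedS.
split => //; rewrite -E.
- have := @big_ord_recl R 0 +%R T (fun j : 'I_T.+1 => padded 0 0 h j ^+ 2).
  rewrite big_ord_recr /= [padded _ _ _ 0]/padded expr0n add0r => <-.
  by rewrite lerDl sqr_ge0.
- have := @big_ord_recl R 0 +%R T (fun j : 'I_T.+1 => padded 0 0 h j.+1 ^+ 2).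
  rewrite big_ord_recr [padded _ _ _ (@ord_max T).+1]padded_out// [0 ^+ 2]expr2 mulr0 [LHS]addr0 => ->.
  by rewrite lerDr sqr_ge0.
Qed.

(** [ramp] climbs from 0 at -2 to 1 at 2, with slope at least 1/4 on [-1, 1]; below -1, where its
    slope dies out, [hinge] supplies a slope of size at least 1. *)
Definition ramp (z : R) : R := smoothstep ((z + 2) / 4).
Definition dramp (z : R) : R := dsmoothstep ((z + 2) / 4) / 4.
Definition hinge (z : R) : R := pospart (- z) ^+ 2 / 2.

Let Y x k := padded 1 (-2) x k.

(* Carmon et al.'s zero-chain, with a hinge penalty in place of the odd
   symmetrisation.  The padding value -2 makes [ramp] vanish, so that the last
   summand is constant. *)
Definition chain x : R :=
  \sum_(k < T.+1) (hinge (Y x k.+1) - smoothstep (Y x k) * ramp (Y x k.+1)).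

Definition dchain x (j : nat) : R :=
  - pospart (- Y x j.+1) - smoothstep (Y x j) * dramp (Y x j.+1)
  - dsmoothstep (Y x j.+1) * ramp (Y x j.+2).

Lemma is_derive_ramp (z : R) : is_derive z 1 ramp (dramp z).
Proof.
have h1 := is_derive_smoothstep ((z + 2) / 4).
have h2 : is_derive z 1 (fun u : R => (u + 2) / 4) (4^-1 : R).
  have h := is_deriveM (is_deriveD (is_derive_id z 1) (is_derive_cst (2 : R) z 1))
    (is_derive_cst (4^-1 : R) z 1).
  by apply: (is_derive_eq h); rewrite addr0 scaler0 add0r /GRing.scale /= mulr1.
exact: (is_derive1_comp (g := fun u : R => (u + 2) / 4) h1 h2).
Qed.

Lemma is_derive_hinge (z : R) : is_derive z 1 hinge (- pospart (- z)).
Proof.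
have h1 := is_derive_sqr_pospart (- z).
have h2 := is_derive1_comp (g := fun u : R => - u) h1 (is_deriveNid z 1).
have := is_deriveZ 2^-1 h2; set F := (X in is_derive _ _ X _).
rewrite (_ : F = hinge); last by apply/funext => u; rewrite /F /hinge mulrC.
by move/is_derive_eq; apply; rewrite /GRing.scale /=; lra.
Qed.

Lemma is_diff_chain x : is_diff x chain (fun h => \sum_(k < T.+1)
  ((- pospart (- Y x k.+1) - smoothstep (Y x k) * dramp (Y x k.+1)) * padded 0 0 h k.+1
   - dsmoothstep (Y x k) * ramp (Y x k.+1) * padded 0 0 h k)).
Proof.
have hk (k : 'I_T.+1) : is_diff x
   (fun z => hinge (Y z k.+1) - smoothstep (Y z k) * ramp (Y z k.+1))
   (fun h => (- pospart (- Y x k.+1) - smoothstep (Y x k) * dramp (Y x k.+1)) * padded 0 0 h k.+1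
   - dsmoothstep (Y x k) * ramp (Y x k.+1) * padded 0 0 h k).
  have p0 := is_diff_padded 1 (-2) x k.
  have p1 := is_diff_padded 1 (-2) x k.+1.
  have a1 := is_diff_comp p1 (is_diff_of_derive (is_derive_hinge (Y x k.+1))).
  have a2 := is_diff_comp p1 (is_diff_of_derive (is_derive_ramp (Y x k.+1))).
  have a3 := is_diff_comp p0 (is_diff_of_derive (is_derive_smoothstep (Y x k))).
  apply: (is_diff_eq (is_diffB a1 (is_diffM a3 a2))).
  apply/funext => h.
  rewrite -[LHS]/(padded 0 0 h k.+1 * - pospart (- Y x k.+1)
    - (smoothstep (Y x k) * (padded 0 0 h k.+1 * dramp (Y x k.+1))
       + ramp (Y x k.+1) * (padded 0 0 h k * dsmoothstep (Y x k)))).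
  ring.
have := is_diff_sum hk.
rewrite (_ : \sum_(i < T.+1) _ = chain); last first.
  by apply/funext => z; rewrite fct_sumE.
by move/is_diff_eq; apply; apply/funext => h; rewrite fct_sumE.
Qed.

Lemma grad_chain x (j : 'I_T) : grad chain x 0 j = dchain x j.
Proof.
rewrite (grad_is_diff j (is_diff_chain x)) big_split /= addrC.
under eq_bigr do rewrite padded_delta.
under [X in _ + X]eq_bigr do rewrite padded_delta eqSS.
(* Coordinate [j] enters as predecessor only in summand j + 1 and as current variable only in
   summand [j]. *)
rewrite (bigD1 (lift ord0 j))//= eqxx big1 ?addr0 => [|i]; last first.
  by rewrite -val_eqE /= => /negbTE; rewrite /bump /= add1n => ->; rewrite mulr0 oppr0.
rewrite (bigD1 (widen_ord (leqnSn T) j))//= eqxx big1 ?addr0 => [|i]; last first.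
  by rewrite -val_eqE /= => /negbTE ->; rewrite mulr0.
by rewrite !mulr1 addrC.
Qed.

(** Each of the [T] nonconstant summands is at most 0 at the origin and at least -1 everywhere. *)
Lemma chain_decrease x : chain 0 - chain x <= T%:R.
Proof.
have YT z : Y z T.+1 = - 2 by exact: padded_out.
rewrite /chain -sumrB big_ord_recr /= !YT.
rewrite (_ : ramp (-2) = 0); last by rewrite /ramp smoothstep_eq0//; lra.
rewrite !mulr0 !subrr addr0.
rewrite -[T in T%:R]card_ord -sumr_const; apply: ler_sum => k _.
have -> : Y 0 k.+1 = 0 by rewrite /Y paddedS mxE.
have h0 : hinge 0 = 0 by rewrite /hinge /pospart oppr0 maxxx expr0n mul0r.
have h1 : 0 <= hinge (Y x k.+1) by rewrite /hinge divr_ge0 ?sqr_ge0.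
have h2 : 0 <= smoothstep (Y 0 k) * ramp 0 by rewrite mulr_ge0 ?smoothstep_ge0.
have h3 : smoothstep (Y x k) * ramp (Y x k.+1) <= 1.
  by rewrite mulr_ile1 ?smoothstep_ge0 ?smoothstep_le1.
by rewrite h0; lra.
Qed.

Lemma mul_lip (a b a' b' A B : R) : `|b| <= B -> `|a'| <= A ->
  `|a * b - a' * b'| <= B * `|a - a'| + A * `|b - b'|.
Proof.
move=> hb ha; rewrite (_ : _ - _ = (a - a') * b + a' * (b - b')); last ring.
rewrite (le_trans (ler_normD _ _))// !normrM; apply: lerD; last by rewrite ler_wpM2r.
by rewrite mulrC ler_wpM2r.
Qed.

Lemma ramp_lip (u v : R) : `|ramp u - ramp v| <= `|u - v|.
Proof.
have := smoothstep_lip ((u + 2) / 4) ((v + 2) / 4).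
rewrite (_ : (u + 2) / 4 - _ = (u - v) / 4); last lra.
by rewrite normrM [`|4^-1|]ger0_norm// /ramp; have := normr_ge0 (u - v); lra.
Qed.

Lemma dramp_lip (u v : R) : `|dramp u - dramp v| <= `|u - v|.
Proof.
have := dsmoothstep_lip ((u + 2) / 4) ((v + 2) / 4).
rewrite (_ : (u + 2) / 4 - _ = (u - v) / 4); last lra.
rewrite -mulrBl !normrM [`|4^-1|]ger0_norm// /dramp; have := normr_ge0 (u - v); lra.
Qed.

Lemma ler_norm01 (z : R) : 0 <= z -> z <= 1 -> `|z| <= 1.
Proof. by move=> ? ?; rewrite ger0_norm. Qed.

Lemma dramp_bound (z : R) : 0 <= dramp z <= 2^-1.
Proof.
have := dsmoothstep_ge0 ((z + 2) / 4); have := dsmoothstep_le2 ((z + 2) / 4).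
by rewrite /dramp; lra.
Qed.

(** The middle constant is 18 = 1 + 1 + 16, from [hinge], [dramp] and [dsmoothstep]; the outer ones
    are the Lipschitz constant of [smoothstep] and the upper bound of [dsmoothstep]. *)
Lemma dchain_lip x y j : `|dchain x j - dchain y j| <=
  2 * `|padded 0 0 (x - y) j| + 18 * `|padded 0 0 (x - y) j.+1|
  + 2 * `|padded 0 0 (x - y) j.+2|.
Proof.
rewrite -!(paddedB 1 (-2)) -!/(Y _ _) /dchain.
set a := Y x j; set b := Y x j.+1; set c := Y x j.+2.
set a' := Y y j; set b' := Y y j.+1; set c' := Y y j.+2.
have h1 : `|pospart (- b) - pospart (- b')| <= `|b - b'|.
  by apply: le_trans (pospart_lip _ _) _; rewrite -opprD normrN.
have h2 : `|smoothstep a * dramp b - smoothstep a' * dramp b'| <=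
    1 * (2 * `|a - a'|) + 1 * `|b - b'|.
  apply: le_trans (@mul_lip _ _ _ _ 1 1 _ _) _.
  - by have /andP[? ?] := dramp_bound b; rewrite ger0_norm//; lra.
  - by rewrite ler_norm01 ?smoothstep_ge0 ?smoothstep_le1.
  by rewrite lerD// ler_wpM2l// ?smoothstep_lip ?dramp_lip.
have h3 : `|dsmoothstep b * ramp c - dsmoothstep b' * ramp c'| <=
    1 * (16 * `|b - b'|) + 2 * `|c - c'|.
  apply: le_trans (@mul_lip _ _ _ _ 2 1 _ _) _.
  - by rewrite ler_norm01 ?smoothstep_ge0 ?smoothstep_le1.
  - by rewrite ger0_norm ?dsmoothstep_ge0 ?dsmoothstep_le2.
  by rewrite lerD// ler_wpM2l// ?dsmoothstep_lip ?ramp_lip.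
move: h1 h2 h3; rewrite !mul1r !ler_norml => /andP[? ?] /andP[? ?] /andP[? ?].
by apply/andP; split; lra.
Qed.

(** Cauchy-Schwarz for three terms: 12 = 3 * 2^2 and 972 = 3 * 18^2. *)
Lemma sqr_lip (e a b c : R) : `|e| <= 2 * `|a| + 18 * `|b| + 2 * `|c| ->
  e ^+ 2 <= 12 * a ^+ 2 + 972 * b ^+ 2 + 12 * c ^+ 2.
Proof.
move=> h; rewrite -(real_normK (num_real e)) -(real_normK (num_real a)).
rewrite -(real_normK (num_real b)) -(real_normK (num_real c)).
move: h (normr_ge0 e); move: `|e| `|a| `|b| `|c| => {e a b c} e a b c h e0.
apply: (@le_trans _ _ ((2 * a + 18 * b + 2 * c) ^+ 2)).
  by rewrite ler_sqr ?nnegrE//; lra.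
by have := sqr_ge0 (2 * a - 18 * b); have := sqr_ge0 (2 * a - 2 * c);
   have := sqr_ge0 (18 * b - 2 * c); lra.
Qed.

(** Summing over [j] gives 12 + 972 + 12 = 996, below 32^2 = 1024 and independent of [T]. *)
Lemma grad_chain_lip x y :
  sqnorm2 (grad chain x - grad chain y) <= 32 ^+ 2 * sqnorm2 (x - y).
Proof.
have [s0 s1 s2] := sum_padded_sqr (x - y).
apply: (@le_trans _ _ (\sum_(j < T) (12 * padded 0 0 (x - y) j ^+ 2
   + 972 * padded 0 0 (x - y) j.+1 ^+ 2 + 12 * padded 0 0 (x - y) j.+2 ^+ 2))).
  rewrite {1}/sqnorm2; apply: ler_sum => j _.
  have -> : (grad chain x - grad chain y : vec R T) 0 j = dchain x j - dchain y j.
    rewrite -(grad_chain x) -(grad_chain y).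
    by move: (grad chain x) (grad chain y) => u v; rewrite !mxE.
  exact/sqr_lip/dchain_lip.
by rewrite !big_split /= -!mulr_sumr s1; have := sqnorm2_ge0 (x - y); lra.
Qed.

Definition fresh x (i : 'I_T) := [forall j : 'I_T, (i <= j)%N ==> (x 0 j == 0)].

Lemma fresh_coord x i (j : 'I_T) : fresh x i -> (i <= j)%N -> x 0 j = 0.
Proof. by move/forallP/(_ j)/implyP => h /h /eqP. Qed.

Lemma grad_chain_fresh x (i : 'I_T) : fresh x i -> grad chain x 0 i = - (smoothstep (Y x i) * dramp 0).
Proof.
move=> fi; rewrite grad_chain /dchain /Y paddedS (fresh_coord fi)//.
by rewrite oppr0 dsmoothstep_eq0// mul0r subr0 /pospart maxxx oppr0 add0r.
Qed.

(** The zero-chain property: the predecessor of [j] is at or after [i], hence zero, and [smoothstep]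
    vanishes there. *)
Lemma grad_chain_fresh0 x (i j : 'I_T) : fresh x i -> (i < j)%N -> grad chain x 0 j = 0.
Proof.
move=> fi ij.
have fj : fresh x j.
  by apply/forallP => l; apply/implyP => jl; rewrite (fresh_coord fi)// (leq_trans (ltnW ij)).
rewrite grad_chain_fresh//; case: j ij fj => -[//|j] jT /= ij fj.
rewrite /Y (paddedS _ _ _ (Ordinal (ltnW jT))) (fresh_coord fi)//.
by rewrite smoothstep_eq0// mul0r oppr0.
Qed.

(** Only the least fresh index contributes, by at most (1 * 1/2)^2. This controls the variance of
    the oracle. *)
Lemma sum_fresh_grad x : \sum_(i | fresh x i) (grad chain x 0 i) ^+ 2 <= 4^-1.
Proof.
have [i0 fi0|nf] := pickP (fresh x); last by rewrite big_pred0.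
case: (arg_minnP (P := fresh x) (fun i : 'I_T => val i) fi0) => i fi mi.
rewrite (bigD1 i)//= big1 ?addr0 => [|j /andP[fj ji]]; last first.
  rewrite (grad_chain_fresh0 fi) ?expr0n//.
  by rewrite ltn_neqAle mi// andbT eq_sym; exact: ji.
rewrite grad_chain_fresh// sqrrN.
have := smoothstep_ge0 (Y x i); have := smoothstep_le1 (Y x i).
have /andP[] := dramp_bound 0; move: (smoothstep _) (dramp _) => a b.
move=> b0 b1 a1 a0; have ab1 : a * b <= 1 * 2^-1 by exact: ler_pM.
have ab0 : 0 <= a * b by exact: mulr_ge0.
rewrite (_ : 4^-1 = (2^-1) ^+ 2); last lra.
by rewrite ler_sqr ?nnegrE//; lra.
Qed.

(** At the first coordinate below 1 the predecessor is at least 1 (the padding value 1 at the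
    start), so [smoothstep] equals 1 there. That partial derivative is at most -1/4, thanks to
    [ramp] on [-1, 1] and to [hinge] below -1. *)
Lemma chain_large_grad x (l : 'I_T) : x 0 l = 0 -> 16^-1 <= sqnorm2 (grad chain x).
Proof.
move=> xl.
have ex : exists k, (k < T)%N && (Y x k.+1 < 1).
  by exists l; rewrite ltn_ord /= /Y paddedS xl ltr01.
case: (ex_minnP ex) => k /andP[kT Yk] mk.
pose j := Ordinal kT.
have Yk1 : 1 <= Y x k.
  case: k kT {j} Yk mk => [//|k] kT _ mk; rewrite leNgt; apply/negP => Yk.
  by have := mk k; rewrite Yk (ltnW kT) => /(_ isT); rewrite ltnn.
have dk : dchain x k <= - 4^-1.
  rewrite /dchain (smoothstep_eq1 Yk1) mul1r.
  have h1 : 0 <= dsmoothstep (Y x k.+1) * ramp (Y x k.+2).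
    by rewrite mulr_ge0 ?dsmoothstep_ge0 ?smoothstep_ge0.
  have h2 := pospart_ge0 (- Y x k.+1).
  have /andP[h3 _] := dramp_bound (Y x k.+1).
  case: (leP (-1) (Y x k.+1)) => h.
    have : 1 <= dsmoothstep ((Y x k.+1 + 2) / 4) by apply: dsmoothstep_ge1; lra.
    by rewrite /dramp in h3 *; lra.
  have : 1 <= pospart (- Y x k.+1) by rewrite /pospart le_max; apply/orP; left; lra.
  lra.
rewrite /sqnorm2 (bigD1 j)//= grad_chain /=.
apply: (@le_trans _ _ (dchain x k ^+ 2)); first nra.
by rewrite lerDl sumr_ge0// => i _; exact: sqr_ge0.
Qed.

End Chain.

(** * Independent coin flips *)

Lemma fsumT_finType (R : numDomainType) (I : finType) (F : I -> \bar R) :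
  (\sum_(i \in [set: I]) F i = \sum_i F i)%E.
Proof.
rewrite (_ : [set: I] = [set` index_enum I]) -?fsbig_seq ?index_enum_uniq//.
by apply/seteqP; split => i //= _; exact: mem_index_enum.
Qed.

Section CoinFlips.
Variables (R : realType) (n : nat) (p : R).
Hypothesis p01 : 0 <= p <= 1.

Definition coin_weight (c : {ffun 'I_n -> bool}) : R :=
  \prod_(i < n) bernoulli_pmf p (c i).

Lemma coin_weight_ge0 c : 0 <= coin_weight c.
Proof. by apply: prodr_ge0 => i _; exact: bernoulli_pmf_ge0. Qed.

Lemma sum_coin_weight : \sum_c coin_weight c = 1.
Proof.
rewrite -(bigA_distr_bigA (fun (i : 'I_n) b => bernoulli_pmf p b)).
by rewrite big1// => i _; rewrite big_bool /bernoulli_pmf /=; lra.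
Qed.

Lemma sum_coin_weight_true (i : 'I_n) : \sum_c coin_weight c * (c i)%:R = p.
Proof.
(* Moving the indicator into factor [i] makes the sum over all flips factorise. *)
pose F (j : 'I_n) (b : bool) : R := bernoulli_pmf p b * (if j == i then b%:R else 1).
transitivity (\sum_(c : {ffun 'I_n -> bool}) \prod_j F j (c j)).
  apply: eq_bigr => c _; rewrite big_split /=; congr (_ * _).
  by rewrite (bigD1 i)//= eqxx big1 ?mulr1// => j /negPf ->.
rewrite -bigA_distr_bigA (bigD1 i)//= [X in _ * X]big1 => [|j /negPf ji].
  by rewrite big_bool /F eqxx /bernoulli_pmf /= mulr0 addr0 !mulr1.
by rewrite big_bool /F ji /bernoulli_pmf /=; lra.
Qed.

(** A union bound: [D] has at most [k] members, each successful with probability [p]. *)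
Lemma sum_coin_weight_some (D : pred 'I_n) (k : nat) :
  (forall i, D i -> (i < k)%N) ->
  \sum_c coin_weight c * [exists i, D i && c i]%:R <= Num.min 1 (k%:R * p).
Proof.
move=> Dk; rewrite le_min; apply/andP; split.
  rewrite -[leRHS]sum_coin_weight; apply: ler_sum => c _.
  by rewrite ler_piMr ?coin_weight_ge0// (ler_nat _ _ 1) leq_b1.
apply: (@le_trans _ _ (\sum_(i | D i) \sum_c coin_weight c * (c i)%:R)).
  rewrite exchange_big /=; apply: ler_sum => c _.
  rewrite -mulr_sumr ler_wpM2l ?coin_weight_ge0//.
  case: existsP => [[i /andP[Di ci]]|_]; last by apply: sumr_ge0 => i _; rewrite ler0n.
  by rewrite (bigD1 i)//= ci lerDl sumr_ge0// => j _; rewrite ler0n.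
under eq_bigr do rewrite sum_coin_weight_true.
rewrite sumr_const -[leLHS]mulr_natl; apply: ler_wpM2r; first by case/andP: p01.
rewrite ler_nat.
rewrite cardE -(size_map val) -(size_iota 0 k); apply: uniq_leq_size.
  by rewrite (map_inj_uniq val_inj) enum_uniq.
by move=> _ /mapP[i iD ->]; rewrite mem_iota add0n Dk//; move: iD; rewrite mem_enum.
Qed.

(** * Histories of flips and conditioning on them *)

Context (dO : measure_display) (Om : measurableType dO) (P : probability Om R).
Variable X : nat -> 'I_n -> Om -> bool.
Hypothesis iidX : iid_with_law P (bernoulli_prob p) X.

(** Flips take finitely many values, so conditional expectations given the past become estimates
    relative to the probability of a cylinder. *)
Definition cylinder (b : nat -> 'I_n -> bool) (k : nat) : set Om :=
  [set w | forall j i, (j < k)%N -> X j i w = b j i].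

Definition record (b : nat -> 'I_n -> bool) k (c : 'I_n -> bool) :=
  fun j => if j == k then c else b j.

Let J k := [seq (j, i) | j <- iota 0 k, i <- index_enum 'I_n].

Let cylinderE b k : cylinder b k =
  \bigcap_(j in [set` J k]) (X j.1 j.2 @^-1` [set b j.1 j.2]).
Proof.
apply/seteqP; split => [w h [j i] /=|w h j i jk].
  move=> /allpairsP[[j' i'] [/= jk _ [-> ->]]]; apply: h.
  by move: jk; rewrite mem_iota add0n.
apply: (h (j, i)) => /=; apply/allpairsP; exists (j, i).
by rewrite mem_iota mem_index_enum.
Qed.

Lemma measurable_cylinder b k : measurable (cylinder b k).
Proof.
rewrite cylinderE; apply: fin_bigcap_measurable; first exact: finite_seq.
move=> j _; have [mX _] := iidX.
by rewrite -[X in measurable X]setTI; exact: mX.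
Qed.

Let prob_cylinder b k :
  P (cylinder b k) = (\prod_(j <- J k) bernoulli_pmf p (b j.1 j.2))%:E.
Proof.
have [_ [lawX indepX]] := iidX.
rewrite cylinderE indepX//; last first.
  apply: allpairs_uniq; rewrite ?iota_uniq ?index_enum_uniq//.
  by move=> [? ?] [? ?] _ _ /= [-> ->].
rewrite -prodEFin; apply: eq_bigr => -[j i] _ /=; rewrite lawX//.
rewrite -[LHS]/(bernoulli_prob p [set b j i]) bernoulli_probE//.
rewrite !diracE /bernoulli_pmf !in_set1.
by case: (b j i); rewrite /= ?mule1 ?mule0 ?adde0 ?add0e.
Qed.

Lemma prob_cylinder_record b k (c : {ffun 'I_n -> bool}) :
  P (cylinder (record b k c) k.+1) = (P (cylinder b k) * (coin_weight c)%:E)%E.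
Proof.
rewrite !prob_cylinder -EFinM; congr _%:E.
rewrite /J -addn1 iotaD !big_allpairs big_cat /= add0n big_seq1; congr (_ * _).
  rewrite big_seq_cond [RHS]big_seq_cond; apply: eq_bigr => j.
  rewrite mem_iota add0n andbT => /andP[_ jk].
  by apply: eq_bigr => i _; rewrite /record /= ltn_eqF.
by apply: eq_bigr => i _; rewrite /record /= eqxx.
Qed.

Lemma cylinder_cover b k :
  cylinder b k `<=` \bigcup_(c in [set: {ffun 'I_n -> bool}]) cylinder (record b k c) k.+1.
Proof.
move=> w h; exists [ffun i => X k i w] => // j i; rewrite ltnS leq_eqVlt /record.
by case: eqP => [-> _|_ /= jk]; [rewrite ffunE|exact: h].
Qed.

(** There are finitely many histories of length [k], so [E] is a finite union of cylinders. This
    settles measurability although algorithms are arbitrary functions. *)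
Lemma measurable_determined (E : set Om) k :
  (forall w w', (forall j i, (j < k)%N -> X j i w = X j i w') -> E w -> E w') ->
  measurable E.
Proof.
move=> detE.
pose b (c : {ffun 'I_k * 'I_n -> bool}) (j : nat) (i : 'I_n) :=
  oapp (fun j' => c (j', i)) true (insub j).
rewrite (_ : E = \bigcup_(c in [set c | cylinder (b c) k `&` E !=set0]) cylinder (b c) k).
  by apply: fin_bigcup_measurable => // c _; exact: measurable_cylinder.
apply/seteqP; split => [w Ew|w [c [w' [bw' Ew']] bw]].
  have bw : cylinder (b [ffun ji : 'I_k * 'I_n => X ji.1 ji.2 w]) k w.
    by move=> j i jk; rewrite /b insubT /= ffunE.
  by exists [ffun ji : 'I_k * 'I_n => X ji.1 ji.2 w] => //; exists w.
by apply: detE Ew' => j i jk; rewrite (bw _ _ jk) (bw' _ _ jk).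
Qed.

(** The law of total probability over the next flips: conditional bounds [v c] average to a bound
    one round earlier. *)
Lemma prob_cylinder_le b k (H : set Om) (B : R) (v : {ffun 'I_n -> bool} -> R) :
  measurable H ->
  (forall c : {ffun 'I_n -> bool}, P (cylinder (record b k c) k.+1 `&` H)
             <= P (cylinder (record b k c) k.+1) * (v c)%:E)%E ->
  \sum_c coin_weight c * v c <= B ->
  (P (cylinder b k `&` H) <= P (cylinder b k) * B%:E)%E.
Proof.
move=> mH hv hB.
have mI c k' : measurable (cylinder c k' `&` H).
  by apply: measurableI => //; exact: measurable_cylinder.
apply: (@le_trans _ _ (\sum_(c \in [set: {ffun 'I_n -> bool}])
    P (cylinder (record b k c) k.+1 `&` H))%E).
  apply: content_sub_fsum => //; first exact: finite_finset.
  move=> w [bw Hw].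
  by have [c _ cw] := cylinder_cover bw; exists c.
apply: (@le_trans _ _ (\sum_(c \in [set: {ffun 'I_n -> bool}])
    (fine (P (cylinder b k)) * (coin_weight c * v c))%:E)%E).
  apply: lee_fsum => [|c _]; [exact: finite_finset|]; apply: (le_trans (hv c)).
  rewrite prob_cylinder_record -[X in (X * _ * _)%E]fineK ?fin_num_measure//; last first.
    exact: measurable_cylinder.
  by rewrite mulrA !EFinM.
rewrite -[X in (_ <= X * _)%E]fineK ?fin_num_measure//; last exact: measurable_cylinder.
rewrite fsumT_finType sumEFin -mulr_sumr -EFinM lee_fin.
by rewrite ler_wpM2l// fine_ge0.
Qed.

End CoinFlips.

(** * Runs of the protocol *)

Section Protocol.
Variables (R : realType) (n T : nat) (p nu t : R) (tau : 'I_n -> R).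
Hypothesis p01 : 0 <= p <= 1.
Hypothesis nu_ge0 : 0 <= nu.
(** [nu] acts as a maximal rate of discovery per unit of time; index [i] stands for worker i + 1. *)
Hypothesis nu_tau : forall i : 'I_n, Num.min 1 (i.+1%:R * p) <= nu * tau i.

Variables (A : algorithm R T.+1) (G : vec R T.+1 -> bool -> vec R T.+1).
Hypotheses (validA : valid_algorithm A) (zeroA : zero_respecting A).

Definition vanishes (d : nat) (x : vec R T.+1) : Prop :=
  forall j : 'I_T.+1, (d <= j)%N -> x 0 j = 0.

Hypothesis G_progress : forall d x (c : bool),
  vanishes d x -> vanishes (d + c) (G x c).

Let O := sync_oracle G tau.

Implicit Types b : nat -> 'I_n -> bool.

Lemma eq_run b b' k : (forall j i, (j < k)%N -> b j i = b' j i) ->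
  run A O b k = run A O b' k.
Proof.
elim: k => [//|k IH] h /=; rewrite IH => [|j i jk]; last by rewrite h// ltnW.
by rewrite (_ : b k = b' k)//; apply/funext => i; exact: h.
Qed.

Lemma time_le_next b k : time A O b k <= (A (run A O b k).1).1.
Proof.
case: validA => A0 Amono; case: k => [|k] /=; first exact: A0.
case: (run A O b k) => gs s /=; case E: (A gs) => [t1 x1].
by case: (O _ _ _ _) => s' g /=; have := Amono gs g; rewrite E.
Qed.

Lemma time_mono b j k : (j <= k)%N -> time A O b j <= time A O b k.
Proof.
elim: k => [|k IH]; first by rewrite leqn0 => /eqP ->.
rewrite leq_eqVlt => /predU1P[->//|jk].
exact: le_trans (IH jk) (time_le_next b k).
Qed.

(* [r] is the starting time of the oracle's pending round, or the current time
   if no round is pending; [d] bounds the number of revealed coordinates. *)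
Definition state_inv b k d r : Prop :=
  let s := (run A O b k).2 in
  [/\ (d <= T.+1)%N,
      forall g, g \in (run A O b k).1 -> vanishes d g,
      r <= time A O b k, time A O b k <= t &
      if s.2 then r = s.1.1 /\ vanishes d s.1.2 else r = time A O b k].

Lemma vanishesW d d' x : (d <= d')%N -> vanishes d x -> vanishes d' x.
Proof. by move=> dd' h j d'j; apply: h; exact: leq_trans d'j. Qed.

Lemma vanishes_query d (gs : seq (vec R T.+1)) :
  (forall g, g \in gs -> vanishes d g) -> vanishes d (A gs).2.
Proof.
move=> h j dj; apply/eqP/negPn/negP => /zeroA /hasP[g gin].
by rewrite h// eqxx.
Qed.

Definition reveals b k (c : 'I_n -> bool) : bool :=
  let s := (run A O b k).2 in
  s.2 && [exists i, (s.1.1 + tau i <= (A (run A O b k).1).1) && c i].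

Lemma run_record b k (c : 'I_n -> bool) :
  run A O (record b k c) k.+1 =
  let: (gs, s) := run A O b k in
  let: (s', g) := O (A gs).1 (A gs).2 s c in (rcons gs g, s').
Proof.
rewrite /= (@eq_run (record b k c) b) => [|j i jk]; last by rewrite /record ltn_eqF.
by rewrite {1}/record eqxx; case: (run A O b k) => gs s; case: (A gs).
Qed.

Lemma time_record b k (c : 'I_n -> bool) :
  time A O (record b k c) k.+1 = (A (run A O b k).1).1.
Proof.
by rewrite /= (@eq_run (record b k c) b) => [|j i jk]//; rewrite /record ltn_eqF.
Qed.

Lemma state_inv_record b k d r (c : 'I_n -> bool) :
  state_inv b k d r -> (d < T.+1)%N -> (A (run A O b k).1).1 <= t ->
  state_inv (record b k c) k.+1 (d + reveals b k c) (A (run A O b k).1).1.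
Proof.
case=> _ hgs _ _ hs dT tk.
rewrite /state_inv time_record run_record /reveals.
case: (run A O b k) hgs hs tk => gs [[st sx] sq] /= hgs hs tk.
have dle (e : bool) : (d + e <= T.+1)%N by case: e; rewrite ?addn1 ?addn0// ltnW.
(* With no round pending the answer is 0 and the query becomes the stored point, which is controlled
   because [A] is zero-respecting. *)
case: sq hs => /= [[_ hsx]|_]; last first.
  rewrite addn0; split => //; [by rewrite -[d]addn0; exact: (dle false)| |].
    by move=> g; rewrite mem_rcons inE => /predU1P[-> j _|/hgs//]; rewrite mxE.
  by split => //; exact: vanishes_query.
set e := [exists _, _]; split => //.
move=> g; rewrite mem_rcons inE => /predU1P[->|/hgs]; last exact/vanishesW/leq_addr.
(* All workers evaluate at the same point [sx], so their sum reveals at most one coordinate however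
   many flips succeed. *)
move=> j dj; rewrite summxE big1// => i done_i.
apply: (G_progress hsx); apply: leq_trans dj; rewrite leq_add2l.
have [ci|] := boolP (c i); last by [].
by rewrite /e (_ : [exists _, _])//; apply/existsP; exists i; rewrite done_i.
Qed.

(** If [i] is the largest index of a finished worker, at most i + 1 workers have finished and the
    round has lasted at least [tau i]. *)
Lemma sum_reveals b k d r : state_inv b k d r ->
  \sum_(c : {ffun 'I_n -> bool}) coin_weight p c * (reveals b k c)%:R
  <= nu * ((A (run A O b k).1).1 - r).
Proof.
case=> _ _ hr _ hs; have rt := le_trans hr (time_le_next b k).
have rhs0 : 0 <= nu * ((A (run A O b k).1).1 - r) by rewrite mulr_ge0// subr_ge0.
rewrite /reveals; case: (run A O b k).2 hs => [[st sx] sq] /=.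
case: sq => /= [[rst _]|_]; last first.
  by rewrite big1// => c _; rewrite mulr0.
pose D i := st + tau i <= (A (run A O b k).1).1.
have [i0 Di0|noD] := pickP D; last first.
  rewrite big1// => c _; rewrite (_ : [exists _, _] = false) ?mulr0//.
  by apply/existsP => -[i /andP[Di _]]; have := noD i; rewrite /D Di.
case: (arg_maxnP (P := D) (fun i : 'I_n => val i) Di0) => i Di imax.
apply: le_trans (sum_coin_weight_some p01 (D := D) (k := i.+1) _) _.
  by move=> j Dj; rewrite ltnS; exact: imax.
apply: le_trans (nu_tau i) _; rewrite ler_wpM2l// rst.
by move: Di; rewrite /D; lra.
Qed.

Context (dO : measure_display) (Om : measurableType dO) (P : probability Om R).
Variable X : nat -> 'I_n -> Om -> bool.
Hypothesis iidX : iid_with_law P (bernoulli_prob p) X.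

Let xs w : nat -> 'I_n -> bool := fun k i => X k i w.

Definition reached (j : nat) : set Om :=
  [set w | time A O (xs w) j <= t /\ query A O (xs w) j 0 ord_max != 0].

Definition reached_between k K : set Om :=
  [set w | exists j, [/\ (k <= j)%N, (j <= k + K)%N & reached j w]].

Lemma measurable_reached j : measurable (reached j).
Proof.
apply: (measurable_determined iidX (k := j)) => w w' ww'.
have E j' : (j' <= j)%N -> run A O (xs w) j' = run A O (xs w') j'.
  by move=> j'j; apply: eq_run => i l il; apply: ww'; exact: leq_trans j'j.
rewrite /reached /= /query (E j)// => -[tw qw]; split => //.
by case: j E tw {qw ww'} => [|j] E; rewrite /= ?E.
Qed.

Lemma measurable_reached_between k K : measurable (reached_between k K).
Proof.
rewrite (_ : reached_between k K =
    \bigcup_(j in [set j | (k <= j <= k + K)%N]) reached j).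
  by apply: bigcup_measurable => j _; exact: measurable_reached.
apply/seteqP; split => w [j].
  by move=> [kj jK rj]; exists j => //=; rewrite kj.
by move=> /= /andP[kj jK] rj; exists j.
Qed.

Lemma unreached_step b k d r w : state_inv b k d r -> (d < T.+1)%N ->
  cylinder X b k w -> ~ reached k w.
Proof.
case=> _ hgs _ _ _ dT bw [_ /eqP]; apply.
rewrite /query (@eq_run (xs w) b) => [|j i jk]; last exact: bw.
exact: (vanishes_query hgs).
Qed.

(* Each step lowers [nu * (t - r)] by at least the conditional expectation of
   the number of newly revealed coordinates, so [d + nu * (t - r)] is a
   supermartingale. *)
Lemma prob_reached_between K k b d r : state_inv b k d r ->
  (P (cylinder X b k `&` reached_between k K)
   <= P (cylinder X b k) * ((d%:R + nu * (t - r)) / T.+1%:R)%:E)%E.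
Proof.
elim: K k b d r => [|K IH] k b d r inv.
all: have [dT hgs hr ht hs] := inv.
all: have b0 : 0 <= nu * (t - r) by rewrite mulr_ge0// subr_ge0 (le_trans hr).
all: have mC := measurable_cylinder iidX b k.
all: have [dE|dN] := eqVneq d T.+1.
(* For d = T + 1 the bound is at least the probability of the cylinder. *)
1,3: apply: (@le_trans _ _ (P (cylinder X b k)));
  [by apply: le_measure; rewrite ?inE//; apply: measurableI => //;
      exact: measurable_reached_between
  |rewrite -[leLHS]mule1; apply: lee_wpmul2l => //; rewrite lee_fin;
   by rewrite ler_pdivlMr// mul1r dE lerDl].
all: have {dN}dT1 : (d < T.+1)%N by rewrite ltn_neqAle dN.
  rewrite (_ : _ `&` _ = set0) ?measure0.
    by rewrite mule_ge0// lee_fin divr_ge0// addr_ge0.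
  apply/seteqP; split => // w [bw [j [kj jk rj]]].
  have jE : j = k by apply/eqP; rewrite eqn_leq kj -[leqRHS]addn0 jk.
  by apply: (unreached_step inv dT1 bw); rewrite -jE.
set t1 := (A (run A O b k).1).1.
(* The last coordinate is still unrevealed at step [k], so the window may start at k + 1. *)
apply: (@le_trans _ _ (P (cylinder X b k `&` reached_between k.+1 K))).
  apply: le_measure; rewrite ?inE; try by apply: measurableI => //; exact: measurable_reached_between.
  move=> w [bw [j [kj jk rj]]]; split => //; exists j; split => //.
  - rewrite ltn_neqAle kj andbT; apply/eqP => kE.
    by apply: (unreached_step inv dT1 bw); rewrite kE.
  - by rewrite addSnnS.
(* Times are nondecreasing: once the next one exceeds [t], nothing more can be reached. *)
have [t1t|tt1] := leP t1 t; last first.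
  rewrite (_ : _ `&` _ = set0) ?measure0.
    by rewrite mule_ge0// lee_fin divr_ge0// addr_ge0.
  apply/seteqP; split => // w [bw [j [kj _ [tj _]]]].
  have := time_mono (xs w) kj; rewrite /= (@eq_run (xs w) b) => [|i l ik]; last exact: bw.
  by rewrite leNgt (le_lt_trans tj tt1).
apply: (prob_cylinder_le p01 iidX
  (v := fun c => ((d + reveals b k c)%:R + nu * (t - t1)) / T.+1%:R)).
- exact: measurable_reached_between.
- by move=> c; exact: (IH _ _ _ _ (state_inv_record c inv dT1 t1t)).
(* The expected gain in [d] is at most nu * (t1 - r), which is exactly the loss when t - r becomes t
   - t1. *)
have := sum_reveals inv; have := sum_coin_weight n p; rewrite -/t1.
set S := (X in X <= _ -> _) => sw hS.
rewrite (_ : \sum_c _ = (S + d%:R + nu * (t - t1)) / T.+1%:R); last first.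
  transitivity (\sum_(c : {ffun 'I_n -> bool}) (coin_weight p c * (reveals b k c)%:R
      + coin_weight p c * (d%:R + nu * (t - t1))) / T.+1%:R).
    by apply: eq_bigr => c _; rewrite natrD; ring.
  by rewrite -mulr_suml big_split /= -mulr_suml sw mul1r addrA.
by rewrite ler_pM2r ?invr_gt0//; lra.
Qed.

(** At the start d = r = 0, and the bound does not depend on [K], so it survives continuity from
    below. *)
Lemma prob_reached : 0 <= t ->
  (P (\bigcup_K reached_between 0 K) <= ((nu * t) / T.+1%:R)%:E)%E.
Proof.
move=> t0; pose b0 (j : nat) (i : 'I_n) := true.
have inv : state_inv b0 0 0 0 by split.
have cvg : (P \o reached_between 0) x @[x --> \oo] -->
    P (\bigcup_K reached_between 0 K).
  apply: nondecreasing_cvg_mu => [K||K K' KK'].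
  - exact: measurable_reached_between.
  - by apply: bigcupT_measurable => K; exact: measurable_reached_between.
  - apply/subsetPset => w [j [j0 jK rj]]; exists j; split => //.
    exact: leq_trans jK _.
rewrite -(cvg_lim _ cvg)//; apply: lime_le; first by apply/cvg_ex; eexists; exact: cvg.
apply: nearW => K /=.
have := prob_reached_between K inv.
rewrite (_ : cylinder X b0 0 = setT); last by apply/seteqP; split.
by rewrite setTI probability_setT mul1e add0r subr0.
Qed.

End Protocol.

(** * The stochastic gradient oracle *)

(** The integral is a supremum over simple functions, one of which is [c] times the indicator of
    [E]. This applies to [inf_grad] without establishing its measurability. *)
Lemma ge0_le_integral_const (R : realType) (dO : measure_display)
    (Om : measurableType dO) (mu : {measure set Om -> \bar R})
    (E : set Om) (c : R) (f : Om -> \bar R) :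
  0 <= c -> measurable E -> (forall w, 0 <= f w)%E ->
  (forall w, E w -> c%:E <= f w)%E ->
  (c%:E * mu E <= \int[mu]_w f w)%E.
Proof.
move=> c0 mE f0 cf; rewrite ge0_integralTE//; apply: ereal_sup_ubound.
exists (scale_nnsfun (indic_nnsfun R mE) c0) => /= [w|].
  rewrite measurable_realfun.mindicE; have [wE|_] := boolP (w \in E); last by rewrite mulr0.
  by rewrite mulr1; apply: cf; rewrite inE in wE.
apply: etrans (sintegralrM mu c (indic_nnsfun R mE)) _.
by congr (_ * _)%E; exact: sintegral_indic.
Qed.

Section BernoulliOracle.
Variables (R : realType) (p : R).
Hypothesis p01 : 0 < p <= 1.

Let p01' : 0 <= p <= 1.
Proof. by case/andP: p01 => /ltW -> ->. Qed.

Lemma integrable_bernoulli (h : bool -> R) :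
  (bernoulli_prob p).-integrable setT (fun c => (h c)%:E).
Proof.
apply/integrableP; split; first by [].
by rewrite integral_bernoulli_prob// -!EFinM -EFinD ltry.
Qed.

Lemma integral_bernoulli (h : bool -> R) :
  (\int[bernoulli_prob p]_c (h c)%:E = (p * h true + (1 - p) * h false)%:E)%E.
Proof.
rewrite integralE !integral_bernoulli_prob//.
rewrite !funeposE !funenegE -!EFinN -!EFin_max -!EFinM -!EFinD; congr _%:E.
have maxN (r : R) : Num.max r 0 = r + Num.max (- r) 0.
  by case: (leP r 0) => ?; case: (leP (- r) 0) => ?; lra.
by rewrite (maxN (h true)) (maxN (h false)) /unstable.onem; ring.
Qed.

Variables (d : nat) (f : vec R d -> R) (noisy : vec R d -> pred 'I_d).

Definition bernoulli_oracle (x : vec R d) (c : bool) : vec R d :=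
  \row_i (if noisy x i then (if c then grad f x 0 i / p else 0) else grad f x 0 i).

Let oracleE x c i : bernoulli_oracle x c 0 i =
  if noisy x i then (if c then grad f x 0 i / p else 0) else grad f x 0 i.
Proof. by rewrite mxE. Qed.

(** The variance is p * (1/p - 1)^2 + (1 - p) = (1 - p) / p times the squared norm of the noisy part
    of the gradient. *)
Lemma admissible_bernoulli_oracle (sigma2 : R) :
  (forall x, (1 - p) * \sum_(i | noisy x i) (grad f x 0 i) ^+ 2 <= p * sigma2) ->
  admissible_oracle f sigma2 (bernoulli_prob p) bernoulli_oracle.
Proof.
case/andP: p01 => p0 p1 hvar; split => [x i|x].
  split; first exact: (integrable_bernoulli (fun c => bernoulli_oracle x c 0 i)).
  rewrite (integral_bernoulli (fun c => bernoulli_oracle x c 0 i)); congr _%:E.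
  rewrite !oracleE; case: ifP => _; last by ring.
  by rewrite mulr0 addr0 mulrC divfK// gt_eqF.
rewrite (integral_bernoulli (fun c => sqnorm2 (bernoulli_oracle x c - grad f x))).
rewrite lee_fin.
have diffE c i : (bernoulli_oracle x c - grad f x : vec R d) 0 i =
    if noisy x i then (if c then grad f x 0 i / p else 0) - grad f x 0 i else 0.
  transitivity (bernoulli_oracle x c 0 i - grad f x 0 i).
    by move: (bernoulli_oracle x c) (grad f x) => u v; rewrite !mxE.
  by rewrite oracleE; case: ifP => //; rewrite subrr.
have E c : sqnorm2 (bernoulli_oracle x c - grad f x) =
    (if c then p^-1 - 1 else 1) ^+ 2 * \sum_(i | noisy x i) (grad f x 0 i) ^+ 2.
  rewrite /sqnorm2 mulr_sumr [RHS]big_mkcond /=; apply: eq_bigr => i _.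
  rewrite diffE; case: ifP => _; last by rewrite expr0n.
  case: c; last by rewrite sub0r sqrrN expr1n mul1r.
  by rewrite -exprMn; congr (_ ^+ 2); ring.
rewrite !E expr1n mul1r -(ler_pM2l p0); apply: le_trans (hvar x).
rewrite mulrA -mulrDl [leLHS]mulrA ler_wpM2r ?sumr_ge0// => [i _|]; first exact: sqr_ge0.
by rewrite le_eqVlt; apply/orP; left; apply/eqP; field; rewrite gt_eqF.
Qed.

End BernoulliOracle.

(** * The chain scaled to prescribed smoothness and gradient size *)

Section RescaledChain.
Variables (R : realType) (T : nat) (a mu : R).
Hypothesis a_gt0 : 0 < a.

Definition rescaled_chain (x : vec R T) : R := a * chain (mu *: x).

Let differentiable_chain (x : vec R T) : differentiable (@chain R T) x.
Proof. by have [] := is_diff_chain x. Qed.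

Lemma grad_rescaled_chain (x : vec R T) :
  grad rescaled_chain x = (a * mu) *: grad (@chain R T) (mu *: x).
Proof. exact: (grad_rescale a mu differentiable_chain). Qed.

Lemma rescaled_chain_in_F_class (Delta L : R) :
  32 * a * mu ^+ 2 = L -> a * T%:R <= Delta -> in_F_class Delta L rescaled_chain.
Proof.
move=> LE aT; split; [|split] => [x|x y|x].
- exact: (differentiable_rescale a mu differentiable_chain).
- have L0 : 0 <= L by rewrite -LE mulr_ge0 ?sqr_ge0// mulr_ge0// ltW.
  rewrite -(ger0_norm L0) -sqrtr_sqr -sqrtrM ?sqr_ge0// ler_wsqrtr//.
  rewrite !grad_rescaled_chain -scalerBr sqnorm2Z.
  apply: (@le_trans _ _ ((a * mu) ^+ 2 * (32 ^+ 2 * (mu ^+ 2 * sqnorm2 (x - y))))).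
    rewrite ler_wpM2l ?sqr_ge0// -sqnorm2Z scalerBr; exact: grad_chain_lip.
  by rewrite -LE le_eqVlt; apply/orP; left; apply/eqP; ring.
- rewrite /rescaled_chain scaler0 -mulrBr (le_trans _ aT)// ler_wpM2l //; first exact: ltW.
  exact: chain_decrease.
Qed.

Lemma rescaled_chain_large_grad (x : vec R T) (l : 'I_T) : x 0 l = 0 ->
  (a * mu) ^+ 2 / 16 <= sqnorm2 (grad rescaled_chain x).
Proof.
move=> xl; rewrite grad_rescaled_chain sqnorm2Z ler_wpM2l ?sqr_ge0//.
by apply: (@chain_large_grad _ _ _ l); rewrite mxE xl mulr0.
Qed.

Definition unexplored (x : vec R T) : pred 'I_T := fresh (mu *: x).

Lemma sum_unexplored_grad (x : vec R T) :
  \sum_(i | unexplored x i) (grad rescaled_chain x 0 i) ^+ 2 <= (a * mu) ^+ 2 / 4.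
Proof.
rewrite grad_rescaled_chain.
under eq_bigr do rewrite mxE exprMn.
by rewrite -mulr_sumr ler_wpM2l ?sqr_ge0// sum_fresh_grad.
Qed.

End RescaledChain.

(** All coordinates from [d] on are noisy: a failed flip erases them, and after a successful one the
    zero-chain property leaves only coordinate [d]. *)
Lemma bernoulli_oracle_progress (R : realType) (T : nat) (a mu p : R) d
    (x : vec R T.+1) (c : bool) : vanishes d x ->
  vanishes (d + c)
    (bernoulli_oracle p (rescaled_chain a mu) (@unexplored R T.+1 mu) x c).
Proof.
move=> hx j dj; rewrite mxE.
have hz : vanishes d (mu *: x : vec R T.+1) by move=> i di; rewrite mxE hx// mulr0.
have fz (i : 'I_T.+1) : (d <= i)%N -> unexplored mu x i.
  move=> di; apply/forallP => l; apply/implyP => il.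
  by rewrite hz//; exact: leq_trans il.
rewrite fz; last exact: leq_trans (leq_addr _ _) dj.
case: c dj => //; rewrite addn1 => dj.
have dT := ltn_trans dj (ltn_ord j).
rewrite grad_rescaled_chain mxE (@grad_chain_fresh0 _ _ _ (Ordinal dT))//.
  by rewrite mulr0 mul0r.
exact: (fz (Ordinal dT)).
Qed.

Lemma min_ord_gt0 (R : realType) n (hn : (0 < n)%N) (F : 'I_n -> R) :
  (forall i, 0 < F i) -> 0 < min_ord hn F.
Proof.
move=> F0; rewrite /min_ord; elim/big_ind : _ => // x y x0 y0.
by rewrite lt_min x0.
Qed.

Lemma min_ord_le (R : realType) n (hn : (0 < n)%N) (F : 'I_n -> R) i :
  min_ord hn F <= F i.
Proof. by rewrite /min_ord; exact: bigmin_le_cond. Qed.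

(** * The lower bound *)

(* Packaging these rationals keeps unification from comparing the images of
   closed rational constants by unary computation. *)
Lemma exists_ratr_inv_nat (m : nat) : (0 < m)%N ->
  exists c : rat, 0 < c /\ forall R : realType, ratr c = m%:R^-1 :> R.
Proof.
move=> m0; exists (m%:R^-1); split; first by rewrite invr_gt0 ltr0n.
by move=> R; rewrite fmorphV /= ratr_nat.
Qed.

(** The choice 64 * eps makes the gradient bound (a * mu)^2 / 16 equal to 4 * eps and the noisy part
    (a * mu)^2 / 4 equal to 16 * eps. *)
Lemma exists_chain_parameters (R : realType) (L Delta eps : R) :
  0 < L -> 0 < Delta -> 0 < eps -> eps <= 2048^-1 * L * Delta ->
  exists (T : nat) (a mu : R),
    [/\ 0 < a, 32 * a * mu ^+ 2 = L, a * T.+1%:R <= Delta &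
        (a * mu) ^+ 2 = 64 * eps] /\ L * Delta / eps <= T.+1%:R * 4096.
Proof.
move=> L_gt0 Delta_gt0 eps_gt0 eps_le.
have [W WE] : exists W, W = L * Delta / eps by exists (L * Delta / eps).
have W_ge : 2048 <= W by rewrite WE ler_pdivlMr//; lra.
(* T + 1 is the floor of W / 2048; a floor that is at least 1 loses at most a factor 2. *)
have [T [T_le T_ge]] : exists T : nat, T.+1%:R * 2048 <= W /\ W <= T.+1%:R * 4096.
  have W1 : 1 <= W / 2048 by lra.
  have W0 : 0 <= W / 2048 by lra.
  have /andP[N1 N2] := truncn_itv W0.
  case: (Num.truncn _) N1 N2 => [|T] N1 N2; first by rewrite ltNge W1 in N2.
  exists T; split; first lra.
  have : (1 : R) <= T.+1%:R by rewrite (ler_nat _ 1).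
  by rewrite -[T.+2%:R]natr1 in N2; lra.
have [s s_gt0 sE] : exists2 s : R, 0 < s & s ^+ 2 = eps.
  by exists (Num.sqrt eps); rewrite ?sqrtr_gt0// sqr_sqrtr// ltW.
(* Solving a * mu = 8 * s together with 32 * a * mu^2 = L; then a = 2048 * eps / L. *)
pose mu := L / (256 * s); pose a := 8 * s / mu.
have mu_gt0 : 0 < mu by rewrite divr_gt0 ?mulr_gt0 ?ltr0n.
have amu : a * mu = 8 * s by rewrite /a divfK// gt_eqF.
exists T, a, mu; rewrite -WE; split => //; split => //.
- by rewrite divr_gt0// mulr_gt0.
- by rewrite expr2 mulrA -(mulrA 32 a) amu /mu; field; rewrite gt_eqF.
- have -> : a * T.+1%:R = eps / L * (T.+1%:R * 2048).
    by rewrite -sE /a /mu; field; rewrite !gt_eqF.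
  apply: (@le_trans _ _ (eps / L * W)).
    by apply: ler_wpM2l => //; rewrite divr_ge0// ltW.
  by rewrite WE le_eqVlt; apply/orP; left; apply/eqP; field; rewrite !gt_eqF.
- by rewrite amu exprMn sE; lra.
Qed.

Lemma exists_success_probability (R : realType) (sigma2 e : R) :
  0 < sigma2 -> 0 < e ->
  exists p : R, [/\ 0 < p, p <= 1, p * sigma2 <= e & p = 1 \/ p * sigma2 = e].
Proof.
move=> s0 e0; exists (Num.min 1 (e / sigma2)); split.
- by rewrite lt_min ltr01 divr_gt0.
- by rewrite ge_min lexx.
- by rewrite -ler_pdivlMr// ge_min lexx orbT.
- by case: (leP 1 (e / sigma2)) => _; [left|right; rewrite divfK// gt_eqF].
Qed.

(** 17 = 1 + 16: the bound 1 on the minimum is used against the summand 1, the other bound against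
    the noise term. *)
Lemma min_success_probability_le (R : realType) (k : nat) (p sigma2 eps : R) :
  0 < p -> 0 < eps -> 0 < sigma2 -> p * sigma2 <= 16 * eps ->
  Num.min 1 (k.+1%:R * p) * (1 + sigma2 / (k.+1%:R * eps)) <= 17.
Proof.
move=> p0 e0 s0 ps; set q := Num.min _ _.
have q_le1 : q <= 1 by rewrite ge_min lexx.
have : q * (sigma2 / (k.+1%:R * eps)) <= 16; last first.
  by rewrite mulrDr mulr1 => h; apply: le_trans (lerD q_le1 h) _; lra.
apply: (@le_trans _ _ (k.+1%:R * p * (sigma2 / (k.+1%:R * eps)))).
  apply: ler_wpM2r; first by rewrite divr_ge0 ?mulr_ge0// ltW.
  by rewrite ge_min lexx orbT.
have -> : k.+1%:R * p * (sigma2 / (k.+1%:R * eps)) = p * sigma2 / eps.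
  by field; rewrite nat1r pnatr_eq0 gt_eqF.
by rewrite ler_pdivrMr.
Qed.

Local Close Scope classical_set_scope.

Theorem mainTheorem10 :
  exists c c' : rat, 0 < c /\ 0 < c' /\
  forall (R : realType) (n : nat) (hn : (0 < n)%N) (sigma2 : R)
         (tau : 'I_n -> R) (L Delta eps : R),
    0 < sigma2 ->
    (forall i, 0 < tau i) ->
    (forall i j : 'I_n, (i <= j)%N -> tau i <= tau j) ->
    0 < L -> 0 < Delta -> 0 < eps -> eps <= ratr c' * L * Delta ->
    forall A : forall d : nat, algorithm R d,
    (forall d, valid_algorithm (A d) /\ zero_respecting (A d)) ->
    let t := ratr c * min_ord hn (fun m : 'I_n =>
               tau m * (L * Delta / eps
                        + sigma2 * L * Delta / ((m.+1)%:R * eps ^+ 2))) in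
    exists (d : nat) (f : vec R d -> R)
           (dS : measure_display) (S : measurableType dS)
           (D0 : probability S R) (G : vec R d -> S -> vec R d),
      in_F_class Delta L f /\
      admissible_oracle f sigma2 D0 G /\
      forall (dO : measure_display) (Om : measurableType dO)
             (P : probability Om R) (X : nat -> 'I_n -> Om -> S),
        iid_with_law P D0 X ->
        (eps%:E < \int[P]_w inf_grad (A d) (sync_oracle G tau)
                              (fun k i => X k i w) f t)%E.
Proof.
have [c1 [c1_gt0 c1E]] := @exists_ratr_inv_nat 512 isT.
have [c' [c'_gt0 c'E]] := @exists_ratr_inv_nat 2048 isT.
(* The estimate of [nu_tau] below needs 2 * 17 * 4096 * c <= 1. *)
exists (c1 * c1), c'; split; first exact: mulr_gt0.
split=> //.
move=> R n hn sigma2 tau L Delta eps sigma2_gt0 tau_gt0 _ L_gt0 Delta_gt0 eps_gt0.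
rewrite rmorphM /= c1E c'E => eps_le A hA.
have [T [a [mu [[a_gt0 LE aT amu2] W_le]]]] :=
  exists_chain_parameters L_gt0 Delta_gt0 eps_gt0 eps_le.
have [p [p0 p1 p_le pE]] :=
  exists_success_probability sigma2_gt0 (mulr_gt0 (ltr0n R 16) eps_gt0).
set F := (fun m : 'I_n => _); set t := _ * min_ord hn F.
have k_gt0 : 0 < 512^-1 * 512^-1 :> R by rewrite mulr_gt0 ?invr_gt0 ?ltr0n.
have F_E m : F m = tau m * (L * Delta / eps * (1 + sigma2 / (m.+1%:R * eps))).
  by rewrite /F; congr (_ * _); field; rewrite nat1r pnatr_eq0 gt_eqF.
have t_gt0 : 0 < t.
  apply: mulr_gt0 k_gt0 _; apply: min_ord_gt0 => m; rewrite F_E.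
  by do 2![apply: mulr_gt0 => //]; rewrite ?addr_gt0 ?divr_gt0 ?mulr_gt0.
have t_le m : t <= 512^-1 * 512^-1 * F m.
  by apply: (ler_wpM2l (ltW k_gt0)); exact: min_ord_le.
move: t t_gt0 t_le => t t_gt0 t_le.
have p01 : 0 < p <= 1 by rewrite p0.
have p01' : 0 <= p <= 1 by rewrite ltW.
pose f := @rescaled_chain R T.+1 a mu.
pose G := bernoulli_oracle p f (@unexplored R T.+1 mu).
exists T.+1, f, _, _, (bernoulli_prob p), G; split; [|split].
- exact: rescaled_chain_in_F_class.
- apply: (admissible_bernoulli_oracle p01) => x.
  have := sum_unexplored_grad a mu x; rewrite amu2 -/f.
  have : 0 <= \sum_(i | unexplored mu x i) grad f x 0 i ^+ 2.
    by apply: sumr_ge0 => i _; exact: sqr_ge0.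
  move: (\sum_(i | _) _) => S S_ge0 S_le.
  (* Either p = 1 and there is no noise, or p * sigma2 = 16 * eps, which bounds [S]. *)
  case: pE => pE; first by rewrite pE subrr mul0r mul1r ltW.
  rewrite pE; apply: (@le_trans _ _ S); last lra.
  by rewrite ler_piMl// lerBlDr lerDl ltW.
move=> dO Om P X iidX.
have [validA zeroA] := hA T.+1.
have N_gt0 : (0 : R) < T.+1%:R by rewrite ltr0n.
(* The rate for which the bound nu * t / (T + 1) of [prob_reached] equals 1/2. *)
pose nu := T.+1%:R / (2 * t).
have nu_ge0 : 0 <= nu by rewrite divr_ge0 ?mulr_ge0// ltW.
have nu_tau (i : 'I_n) : Num.min 1 (i.+1%:R * p) <= nu * tau i.
  have q17 := min_success_probability_le i p0 eps_gt0 sigma2_gt0 p_le.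
  have q0 : 0 < Num.min 1 (i.+1%:R * p) by rewrite lt_min ltr01 mulr_gt0.
  have b0 : 0 <= 1 + sigma2 / (i.+1%:R * eps).
    by rewrite addr_ge0// divr_ge0 ?mulr_ge0// ltW.
  have W0 : 0 <= L * Delta / eps by rewrite divr_ge0 ?mulr_ge0// ltW.
  rewrite /nu mulrAC ler_pdivlMr; last exact: mulr_gt0.
  have := t_le i; rewrite F_E.
  move: q17 q0 b0 W0 W_le N_gt0 (tau_gt0 i).
  move: (Num.min _ _) (1 + _) (L * Delta / eps) (T.+1%:R) (tau i).
  move=> q b W N u q17 q0 b0 W0 WN N0 u0 tu.
  have h : q * b * W <= 17 * (N * 4096) by apply: ler_pM => //; rewrite mulr_ge0// ltW.
  (* With [u] for [tau i], this is the upper bound on [t] multiplied by 2 * q and regrouped so that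
     [h] applies. *)
  apply: (@le_trans _ _ (u * (2 * (512^-1 * 512^-1) * (q * b * W)))).
    rewrite (_ : u * _ = q * (2 * (512^-1 * 512^-1 * (u * (W * b))))); last by ring.
    by rewrite ler_wpM2l ?(ltW q0)// ler_wpM2l.
  rewrite [N * u]mulrC; apply: (ler_wpM2l (ltW u0)).
  move: (q * b * W) h => z h; clear - N0 h.
  (* 136 = 17 * 4096 / 512; the second factor 1/512 then absorbs 2 * 136. *)
  have h1 : 512^-1 * z <= 136 * N by lra.
  rewrite -!mulrA; move: (512^-1 * z) h1 => y h1.
  lra.
have hP := prob_reached p01' nu_ge0 nu_tau validA zeroA
  (@bernoulli_oracle_progress R T a mu p) iidX (ltW t_gt0).
set B := (\bigcup_K _)%classic in hP.
have mB : measurable B by apply: bigcupT_measurable => K; exact: (measurable_reached_between _ _ _ _ iidX).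
have PB : (P B <= (2^-1)%:E)%E.
  apply: le_trans hP _; rewrite (_ : nu * t / T.+1%:R = 2^-1)//.
  by rewrite /nu; move: (T.+1%:R) N_gt0 => N N0; field; rewrite !gt_eqF.
(* Off [B] every query made by time [t] has last coordinate 0, hence squared gradient norm at least
   4 * eps. As [P B] is at most 1/2, the expectation is at least 2 * eps. *)
apply: (@lt_le_trans _ _ ((4 * eps)%:E * P (~` B)%classic)%E); last first.
  apply: ge0_le_integral_const.
  - by rewrite mulr_ge0// ltW.
  - exact: measurableC.
  - by move=> w; apply: le_ereal_inf_tmp => _ [k _ <-]; rewrite lee_fin sqnorm2_ge0.
  - move=> w Bw; apply: le_ereal_inf_tmp => _ [k tk <-]; rewrite lee_fin.
    have : query (A T.+1) (sync_oracle G tau) (fun k i => X k i w) k 0 ord_max = 0.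
      by apply/eqP/negPn/negP => qk; apply: Bw; exists k => //; exists k; split.
    move/(rescaled_chain_large_grad a mu); rewrite amu2 -/f.
    by apply: le_trans; lra.
rewrite probability_setC//.
rewrite -(fineK (fin_num_measure P _ mB)) in PB *.
rewrite lee_fin in PB.
by rewrite -EFinB -EFinM lte_fin; nra.
Qed.
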